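(* Let $k\ge 2$ be a fixed integer and $\varepsilon>0$ a fixed real number. For a prime $p$ let $p'$ denote the least prime exceeding $p$. Consider the two functions $$\lambda_1(t)=\frac{1}{\mathrm{Log}_k(t)},\qquad \lambda_2(t)=\frac{1}{\mathrm{Log}_k(t)\,(\log_k t)^{\varepsilon}} .$$ Assume that for each of the choices $\lambda=\lambda_1$ and $\lambda=\lambda_2$ one has, as $x\to\infty$, $$\frac{1}{\pi(x)}\#\left\{p\le x:\ p \text{ prime},\ \frac{p'-p}{\log p}\le\lambda(p)\right\}\sim \int_0^{\lambda(x)}e^{-u}\,du = 1-e^{-\lambda(x)} .$$ Then, as $x\to\infty$, $$\sum_{\substack{p\le x\\ p'-p\le \lambda_1(p)\log p}}\frac1p\ \sim\ \log_{k+1}x\ \to\ \infty ,$$ whereas $$\sum_{\substack{p\le x\\ p'-p\le \lambda_2(p)\log p}}\frac1p\quad\text{is bounded},$$ the sums being over primes $p$.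
   Context: $\log_1=\log$ is the natural logarithm and, for $j\ge 2$, $\log_j=\log\log_{j-1}$ is the $j$-th iterated logarithm. For $k\ge2$, $\mathrm{Log}_k(t)=\prod_{2\le j\le k}\log_j t$. The finitely many small integers at which these functions are not defined are ignored: all counts and sums are restricted to those primes $p$ for which $\log_k p$ is defined and positive. $\pi(x)$ is the number of primes $\le x$. *)

(* Defs.v *)
From mathcomp Require Import all_boot all_order all_algebra.
From mathcomp Require Import all_classical all_reals all_analysis.

Set Implicit Arguments.
Unset Strict Implicit.
Unset Printing Implicit Defensive.

Import Order.TTheory GRing.Theory Num.Theory.
Import numFieldNormedType.Exports.

Local Open Scope classical_set_scope.
Local Open Scope ring_scope.

Definition iterlog (R : realType) (j : nat) (t : R) : R := iter j (@ln R) t.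

Definition Log (R : realType) (k : nat) (t : R) : R :=
  \prod_(2 <= j < k.+1) iterlog j t.

(* [ln] is total, so "log_k t is defined and positive" has to be spelled out:
   log_k t is defined iff log_j t > 0 for all 1 <= j < k. *)
Definition iterlog_pos (R : realType) (k : nat) (t : R) : bool :=
  all (fun j => 0 < iterlog j t) (iota 1 k).

Fact next_prime_exists (p : nat) : exists q : nat, (p < q)%N && prime q.
Proof. by have [q pq prq] := prime_above p; exists q; rewrite pq. Qed.

Definition next_prime (p : nat) : nat := ex_minn (next_prime_exists p).

Definition primes_le (R : realType) (x : R) : seq nat :=
  [seq p <- iota 0 (Num.truncn x).+1 | prime p].

Lemma mem_primes_le (R : realType) (x : R) (p : nat) :
  (p \in primes_le x) = prime p && (p%:R <= x).
Proof.
rewrite mem_filter mem_iota /= add0n ltnS; case: (boolP (prime p)) => //= pp.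
have [x0|x0] := leP 0 x; first by rewrite truncn_ge_nat.
have /truncn0Pn-> : ~~ (1 <= x) by rewrite -ltNge (lt_trans x0).
rewrite leNgt (lt_le_trans x0) ?ler0n// leqn0.
by apply/negbTE; rewrite -lt0n prime_gt0.
Qed.

Definition primepi (R : realType) (x : R) : nat := size (primes_le x).

Definition primes_dom (R : realType) (k : nat) (x : R) : seq nat :=
  [seq p <- primes_le x | iterlog_pos k (p%:R : R)].

Definition prime_gap (R : realType) (p : nat) : R := (next_prime p)%:R - p%:R.

Definition small_gap_count (R : realType) (k : nat) (lam : R -> R) (x : R)
    : nat :=
  count (fun p : nat => prime_gap R p / ln p%:R <= lam p%:R) (primes_dom k x).

Definition small_gap_sum (R : realType) (k : nat) (lam : R -> R) (x : R) : R :=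
  \sum_(p <- primes_dom k x | prime_gap R p <= lam p%:R * ln p%:R) 1 / p%:R.

Definition lambda1 (R : realType) (k : nat) (t : R) : R := 1 / Log k t.

Definition lambda2 (R : realType) (k : nat) (eps : R) (t : R) : R :=
  1 / (Log k t * iterlog k t `^ eps).

(* Needed for the Landau notations to accept [pinfty_nbhs R]. *)
Canonical pinfty_filter_on (R : realType) :=
  FilterType (pinfty_nbhs R) filter_filter.

Definition asymp_equiv (R : realType) (f g : R -> R) : Prop :=
  (f : R -> R^o) ~_(pinfty_nbhs R) (g : R -> R^o).

Lemma asymp_equivP (R : realType) (f g : R -> R) :
  asymp_equiv f g <->
  forall e : R, 0 < e -> \forall x \near +oo, `|f x - g x| <= e * `|g x|.
Proof. exact: eqaddoP. Qed.

Definition small_gap_law (R : realType) (k : nat) (lam : R -> R) : Prop :=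
  asymp_equiv
    (fun x => (small_gap_count k lam x)%:R / (primepi x)%:R)
    (fun x => \int[@lebesgue_measure R]_(u in `[0, lam x]) expR (- u)).

Lemma Rintegral_expRN (R : realType) (a : R) : 0 <= a ->
  \int[@lebesgue_measure R]_(u in `[0, a]) expR (- u) = 1 - expR (- a).
Proof.
rewrite le_eqVlt => /predU1P[<-|a0].
  by rewrite set_itv1 Rintegral_set1 oppr0 expR0 subrr.
have cexpN : continuous (fun u : R => expR (- u)).
  by move=> x; apply: continuous_comp;
    [exact: opp_continuous|exact: continuous_expR].
rewrite /Rintegral (@continuous_FTC2 _ (fun u => expR (- u))
  (fun u => - expR (- u))) //=.
- by rewrite oppr0 expR0 opprK addrC.
- exact: continuous_subspaceT.
- split => [x _||]; first exact: ex_derive.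
  + by apply: cvg_at_right_filter; apply: cvgN; exact: cexpN.
  + by apply: cvg_at_left_filter; apply: cvgN; exact: cexpN.
- by move=> x _; rewrite derive1E derive_val /GRing.scale /= mulrN1 !opprK.
Qed.

(* Main.v *)
(** By Abel summation the sum of [1/p] over the counted primes [p <= n] is, up
    to [O(1)], the sum of [N(m) / (m (m + 1))] with [N] the counting function,
    and the hypothesis replaces [N] by [pi * lambda].  The prime number theorem
    is not needed: with [b(m) = pi(m) / (m (m + 1))], the same Abel summation
    and Mertens' second theorem give [sum b(m) = log log n + O(1)].  Moreover
    any estimate [F = L + O(1)], [L] increasing by bounded steps, passes to
    [sum (F(m + 1) - F(m)) / L(m + 1) = log L + O(1)].  The same step leads from
    Mertens' first theorem to the second, and iterating it inserts the factors
    of [1 / Log_k] one at a time, so that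
    [sum b(m) / Log_k(m) = log_(k+1) n + O(1)].  For [lambda2] the extra factor
    is [exp(- eps log_(k+1))], and [sum exp(- eps G) dG] is bounded by a
    telescoping sum. *)

Require Import Defs.
From mathcomp Require Import all_boot all_order all_algebra.
From mathcomp Require Import all_classical all_reals all_analysis.
From mathcomp Require Import lra zify ring.

Set Implicit Arguments.
Unset Strict Implicit.
Unset Printing Implicit Defensive.

Import Order.TTheory GRing.Theory Num.Theory.
Import numFieldNormedType.Exports.

Local Open Scope classical_set_scope.
Local Open Scope ring_scope.

(** * Primes and factorials *)

Lemma prime_dvd_fact (p n : nat) : prime p -> (p %| n`!)%N = (p <= n)%N.
Proof.
move=> pp; apply/idP/idP => [|pn]; last first.
  by rewrite dvdn_fact// prime_gt0.
elim: n => [|n IH]; first by rewrite fact0 dvdn1 => /eqP p1; rewrite p1 in pp.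
by rewrite factS Euclid_dvdM// => /orP[/dvdn_leq->//|/IH/leqW].
Qed.

Lemma prod_primes_dvdn (a b N : nat) :
  (forall p, (a <= p < b)%N -> prime p -> (p %| N)%N) ->
  (\prod_(a <= p < b | prime p) p %| N)%N.
Proof.
elim: b => [|b IH] dvdN; first by rewrite big_geq// dvd1n.
have [ab|ba] := leqP a b; last by rewrite big_geq// dvd1n.
rewrite big_mkcond/= big_nat_recr//= -big_mkcond/=.
have dvdN' : (\prod_(a <= p < b | prime p) p %| N)%N.
  by apply: IH => p /andP[ap pb]; apply: dvdN; rewrite ap ltnW.
case: ifP => pb; last by rewrite muln1.
rewrite Gauss_dvd ?dvdN'/= ?dvdN ?ab ?leqnn//.
rewrite big_seq_cond; elim/big_ind: _ => [|x y|p]; first by rewrite coprime1n.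
  by rewrite coprimeMl => -> ->.
rewrite mem_index_iota => /andP[/andP[_ ltpb] pp].
by rewrite prime_coprime// dvdn_prime2// neq_ltn ltpb.
Qed.

Lemma bin_le_exp2 (n m : nat) : (m <= n)%N -> ('C(n, m) <= 2 ^ n)%N.
Proof.
move=> mn; rewrite -(addn1 1) expnDn (bigD1 (Ordinal (mn : (m < n.+1)%N)))//=.
by rewrite !exp1n !muln1 leq_addr.
Qed.

(** [p] divides [n!] but neither [m!] nor [(n - m)!], both being factorials of numbers below [p]. *)
Lemma prime_dvd_bin (p n m : nat) : prime p -> (m <= n)%N ->
  (m < p <= n)%N -> (n - m < p)%N -> (p %| 'C(n, m))%N.
Proof.
move=> pp mn /andP[mp pn] nmp.
have : (p %| n`!)%N by rewrite prime_dvd_fact.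
rewrite -(bin_fact mn) !Euclid_dvdM// !prime_dvd_fact//.
by rewrite leqNgt mp leqNgt nmp !orbF.
Qed.

(* With [h = ceil(n/2)], every prime in ]h, n] divides ['C(n, h) <= 2 ^ n]. *)
Lemma primorial_le (n : nat) : (\prod_(0 <= p < n.+1 | prime p) p <= 8 ^ n)%N.
Proof.
have [m] := ubnP n; elim: m n => // m IH [|[|n]] ltnm.
- by rewrite big_mkcond big_nat1.
- by rewrite big_mkcond big_nat_recr//= big_nat1.
set N := n.+2; set h := uphalf N.
have hN : (h <= N)%N by rewrite /h /N uphalfE; lia.
have hltN : (h < N)%N by rewrite /h /N uphalfE; lia.
rewrite (@big_cat_nat _ _ _ h.+1)//=.
have -> : (8 ^ N = 8 ^ h * 8 ^ (N - h))%N by rewrite -expnD subnKC.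
apply: leq_mul; first by apply: IH; rewrite (leq_trans hltN).
apply: (@leq_trans 'C(N, h)).
  apply: dvdn_leq; first by rewrite bin_gt0.
  apply: prod_primes_dvdn => p /andP[hp pN] pp.
  have h2 : (N - h <= h)%N by rewrite /h /N uphalfE; lia.
  by apply: prime_dvd_bin; rewrite ?hp ?(leq_ltn_trans h2).
apply: (leq_trans (bin_le_exp2 hN)).
(* What remains is [N <= 3 (N - h)] with [N - h = floor(N / 2)], true from [N = 2] on; this factor 3
   is why the base is [8 = 2 ^ 3]. *)
rewrite (_ : 8 = 2 ^ 3)%N// -expnM leq_exp2l//.
by rewrite /h /N uphalfE; lia.
Qed.

Lemma logn_fact_ge (p n : nat) : prime p -> (n %/ p <= logn p n`!)%N.
Proof.
move=> pp; case: n => [|n]; first by rewrite div0n.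
by rewrite logn_fact// big_ltn// expn1 leq_addr.
Qed.

Lemma logn_fact_le (p n : nat) : prime p -> (logn p n`! * p.-1 <= n)%N.
Proof.
move=> pp; rewrite logn_fact// mulnC.
(* The extra term [n %/ p ^ j] closes the induction: [p] times [n %/ p ^ j.+1] is at most
   [n %/ p ^ j]. *)
suff H j : (p.-1 * (\sum_(1 <= k < j.+1) n %/ p ^ k) + n %/ p ^ j <= n)%N.
  by apply: leq_trans (H n); rewrite leq_addr.
elim: j => [|j IH]; first by rewrite big_geq// muln0 expn0 divn1.
rewrite big_nat_recr//= mulnDr -addnA; apply: leq_trans IH.
rewrite leq_add2l -mulSnr prednK ?prime_gt0// mulnC expnSr divnMA.
exact: leq_divM.
Qed.

Lemma ln_sum_logn (R : realType) (N n : nat) : (0 < N)%N ->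
  (forall p, prime p -> (p %| N)%N -> (p <= n)%N) -> (n <= N)%N ->
  ln (N%:R : R) = \sum_(0 <= p < n.+1 | prime p) (logn p N)%:R * ln p%:R.
Proof.
move=> N0 Nn nN; rewrite -{1}(partnT N0) (@widen_partn N predT)// big_mkcond/=.
rewrite (@big_cat_nat _ _ _ n.+1)//= [X in (_ * X)%N]big_nat_cond.
rewrite [X in (_ * X)%N]big1 ?muln1; last first.
  move=> p /andP[/andP[np _] _]; rewrite lognE N0/=.
  case: ifP => // /andP[pp dp]; by move: (Nn p pp dp); rewrite leqNgt np.
elim: n.+1 => [|m IH]; first by rewrite !big_geq// ln1.
rewrite big_nat_recr//= [RHS]big_mkcond [RHS]big_nat_recr//= -big_mkcond/= -IH.
case: (boolP (prime m)) => [pm|/negbTE pm]; last first.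
  by rewrite lognE pm/= expn0 muln1 addr0.
have P0 : (0 < \prod_(0 <= p < m) p ^ logn p N)%N.
  apply: prodn_gt0 => i; case: (posnP i) => [->|i0]; first by rewrite lognE.
  by rewrite expn_gt0 i0.
have m0 := prime_gt0 pm.
rewrite natrM lnM ?posrE ?ltr0n ?expn_gt0 ?m0//.
by rewrite natrX lnXn ?ltr0n// mulr_natl.
Qed.

(** * Mertens' first theorem *)

(** This is [ln (1 + u) <= u] at [u = (y - x) / x]. With its mirror image below it stands in for the
    derivative of [ln]. *)
Lemma ln_sub_le (R : realType) (x y : R) :
  0 < x -> 0 < y -> ln y - ln x <= (y - x) / x.
Proof.
move=> x0 y0; rewrite -ln_div// (_ : y / x = 1 + (y - x) / x); last first.
  by rewrite mulrBl divff ?gt_eqF// addrC subrK.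
by apply: le_ln1Dx; rewrite mulrBl divff ?gt_eqF// ltrBrDl subrr divr_gt0.
Qed.

Lemma ln_sub_ge (R : realType) (x y : R) :
  0 < x -> 0 < y -> (y - x) / y <= ln y - ln x.
Proof.
move=> x0 y0; have := @ln_sub_le R y x y0 x0.
by rewrite -lerN2 opprB -mulNr opprB.
Qed.

Lemma ln_nat_ge0 (R : realType) (n : nat) : 0 <= ln (n%:R : R).
Proof.
by case: n => [|n]; [rewrite ln0|apply: ln_ge0; rewrite ler1n].
Qed.

Lemma ln_factS (R : realType) (n : nat) :
  ln ((n.+1)`!%:R : R) = ln n.+1%:R + ln n`!%:R.
Proof. by rewrite factS natrM lnM// posrE ltr0n// fact_gt0. Qed.

Lemma ln_fact_le (R : realType) (n : nat) :
  ln (n`!%:R : R) <= n%:R * ln n%:R.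
Proof.
elim: n => [|n IH]; first by rewrite fact0 ln1 mul0r.
rewrite ln_factS [leRHS]mulr_natl [leRHS]mulrS -[_ *+ n]mulr_natl lerD2l.
apply: (le_trans IH); case: n {IH} => [|n]; first by rewrite !mul0r.
by rewrite ler_wpM2l// ler_ln ?posrE ?ltr0n// ler_nat.
Qed.

(** Half of a crude Stirling formula; the induction rests on [x (ln (x + 1) - ln x) <= 1]. *)
Lemma ln_fact_ge (R : realType) (n : nat) :
  n%:R * ln n%:R - n%:R <= ln (n`!%:R : R).
Proof.
elim: n => [|n IH]; first by rewrite fact0 ln1 mul0r subr0.
rewrite ln_factS; case: n IH => [|n] IH.
  by rewrite !ln1 mulr0 sub0r addr0 oppr_le0.
have := @ln_sub_le R n.+1%:R n.+2%:R.
rewrite !ltr0n -natrB// subSnn mul1r => /(_ isT isT).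
rewrite -[leRHS]mul1r ler_pdivlMr ?ltr0n// => h.
move: IH h; rewrite -[n.+2%:R]natr1; nra.
Qed.

(* [(ln x + 2) / x] decreases by at least [ln (x + 1) / (x (x + 1))] from [x] to
   [x + 1], so the sum telescopes. *)
Lemma sum_ln_div_sq_le (R : realType) (n : nat) : (0 < n)%N ->
  \sum_(0 <= p < n.+1 | prime p) ln p%:R / (p%:R * p.-1%:R) <=
  2 - (ln n%:R + 2) / n%:R :> R.
Proof.
elim: n => // -[|n] IH _.
  by rewrite big_mkcond big_nat_recr// big_nat1/= ln1; lra.
rewrite big_mkcond big_nat_recr//= -big_mkcond/=.
have := IH isT; move: (\sum_(0 <= p < _ | _) _) => S hS.
apply: (@le_trans _ _ (S + ln n.+2%:R / (n.+2%:R * n.+1%:R))).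
  rewrite lerD2l; case: ifP => // _.
  by rewrite divr_ge0 ?ln_nat_ge0// mulr_ge0// ler0n.
have := @ln_sub_le R n.+1%:R n.+2%:R.
rewrite !ltr0n -natrB// subSnn => /(_ isT isT).
rewrite -[in n.+2%:R]natr1 => h0.
have x0 : 1 <= (n.+1%:R : R) by rewrite ler1n.
move: h0 x0 hS; move: (n.+1%:R) => x.
move: (ln (x + 1)) (ln x) => b a h x1 hS.
apply: (le_trans (lerD hS (lexx _))).
rewrite -subr_ge0.
have -> : 2 - (b + 2) / (x + 1) - (2 - (a + 2) / x + b / ((x + 1) * x)) =
          (2 - (x + 1) * (b - a)) / ((x + 1) * x).
  by field; rewrite !gt_eqF//; lra.
apply: divr_ge0; last by nra.
rewrite subr_ge0; apply: (@le_trans _ _ ((x + 1) * (1 / x))).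
  by rewrite ler_wpM2l//; lra.
rewrite mulrA ler_pdivrMr; lra.
Qed.

(** Chebyshev's upper bound, the logarithm of [primorial_le]. *)
Lemma theta_le (R : realType) (n : nat) :
  \sum_(0 <= p < n.+1 | prime p) ln p%:R <= n%:R * ln 8 :> R.
Proof.
have -> : \sum_(0 <= p < n.+1 | prime p) ln p%:R =
          ln ((\prod_(0 <= p < n.+1 | prime p) p)%:R : R).
  pose K (y : nat) (x : R) := (0 < y)%N /\ x = ln y%:R.
  suff [] : K (\prod_(0 <= p < n.+1 | prime p) p)%N
    (\sum_(0 <= p < n.+1 | prime p) ln p%:R) by [].
  apply: (big_rec2 K) => [|p y x pp [x0 ->]]; first by split; rewrite // ln1.
  split; first by rewrite muln_gt0 (prime_gt0 pp).
  by rewrite natrM lnM ?posrE ?ltr0n ?(prime_gt0 pp).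
rewrite mulr_natl -lnXn ?ltr0n// ler_ln ?posrE ?exprn_gt0 ?ltr0n//.
  by rewrite -natrX ler_nat primorial_le.
by apply: prodn_cond_gt0 => p /prime_gt0.
Qed.

(** The expansion [ln n! = sum v_p(n!) ln p], where [n / p - 1 <= v_p(n!) <= n / (p - 1)], is
    compared with [n ln n - n <= ln n! <= n ln n]. In the constant, 3 is 1 from Stirling plus 2 from
    [sum ln p / (p (p - 1))], and [ln 8] is Chebyshev's. *)
Lemma mertens1 (R : realType) (n : nat) : (0 < n)%N ->
  `|\sum_(0 <= p < n.+1 | prime p) ln p%:R / p%:R - ln n%:R| <= 3 + ln 8 :> R.
Proof.
move=> n0; have n0R : 0 < (n%:R : R) by rewrite ltr0n.
have factE := @ln_sum_logn R n`! n (fact_gt0 n).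
have {}factE : ln (n`!%:R : R) =
    \sum_(0 <= p < n.+1 | prime p) (logn p n`!)%:R * ln p%:R.
  apply: factE => [p pp|]; first by rewrite prime_dvd_fact.
  by rewrite dvdn_leq ?fact_gt0// dvdn_fact// n0 leqnn.
have l8 : 0 <= ln (8 : R) by apply: ln_nat_ge0.
set a := \sum_(0 <= p < n.+1 | prime p) _.
rewrite ler_norml; apply/andP; split.
(* Lower bound for [a], from [1 / (p - 1) = 1 / p + 1 / (p (p - 1))]. *)
- have : ln (n`!%:R : R) <=
      n%:R * (a + \sum_(0 <= p < n.+1 | prime p) ln p%:R / (p%:R * p.-1%:R)).
    rewrite factE /a -big_split/= big_distrr/=; apply: ler_sum => p pp.
    have p1 : 1 <= (p.-1%:R : R).
      by rewrite ler1n -subn1 subn_gt0 prime_gt1.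
    have pE : (p%:R : R) = p.-1%:R + 1.
      by rewrite natr1 prednK// prime_gt0.
    rewrite (_ : _ + _ = (p.-1%:R)^-1 * ln p%:R); last first.
      by rewrite pE; field; rewrite !gt_eqF//; lra.
    rewrite mulrA ler_wpM2r ?ln_nat_ge0// ler_pdivlMr; last by lra.
    by rewrite -natrM ler_nat logn_fact_le.
  have := @sum_ln_div_sq_le R n n0; have := @ln_fact_ge R n.
  move: (\sum_(0 <= p < _ | _) _) => S h1 h2 h3.
  have h4 : n%:R * S <= n%:R * 2.
    rewrite ler_wpM2l ?ler0n//; apply: (le_trans h2).
    by rewrite gerBl divr_ge0 ?ler0n// addr_ge0 ?ln_nat_ge0.
  have : n%:R * (ln n%:R - 3) <= n%:R * a :> R by nra.
  by rewrite ler_pM2l//; lra.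
(* Upper bound for [a]: rounding [n / p] down costs at most [ln p] per prime, hence at most [n ln 8]
   in all. *)
- have : n%:R * a - n%:R * ln 8 <= ln (n`!%:R : R).
    apply: (@le_trans _ _ (n%:R * a - \sum_(0 <= p < n.+1 | prime p) ln p%:R)).
      by rewrite lerB// theta_le.
    rewrite factE /a big_distrr/= -sumrB; apply: ler_sum => p pp.
    rewrite mulrA mulrAC -{2}[ln p%:R]mul1r -mulrBl ler_wpM2r ?ln_nat_ge0//.
    rewrite lerBlDr natr1 ler_pdivrMr ?ltr0n ?prime_gt0// -natrM ler_nat.
    rewrite ltnW// -ltn_divLR ?prime_gt0// ltnS.
    exact: logn_fact_ge.
  have := @ln_fact_le R n => h1 h2.
  have : n%:R * a <= n%:R * (ln n%:R + ln 8) :> R by nra.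
  by rewrite ler_pM2l//; lra.
Qed.

(** * Abel summation and Mertens' second theorem *)

(** This is [F = G + O(1)]; the threshold is explicit because it is also the lower limit of the sums
    compared. *)
Definition close_from (R : realType) (n0 : nat) (F G : nat -> R) : Prop :=
  exists C : R, forall n, (n0 <= n)%N -> `|F n - G n| <= C.

Lemma close_from_trans (R : realType) (n0 : nat) (F G H : nat -> R) :
  close_from n0 F G -> close_from n0 G H -> close_from n0 F H.
Proof.
move=> [C FG] [D GH]; exists (C + D) => n n0n.
by rewrite (le_trans (ler_distD (G n) _ _))// lerD ?FG ?GH.
Qed.

Lemma close_from_sym (R : realType) (n0 : nat) (F G : nat -> R) :
  close_from n0 F G -> close_from n0 G F.
Proof. by move=> [C FG]; exists C => n n0n; rewrite distrC FG. Qed.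

Lemma eq_close_from (R : realType) (n0 : nat) (F F' G : nat -> R) :
  (forall n, (n0 <= n)%N -> F n = F' n) -> close_from n0 F G ->
  close_from n0 F' G.
Proof. by move=> FF' [C FG]; exists C => n n0n; rewrite -FF'// FG. Qed.

Lemma close_from_shift (R : realType) (n0 n1 : nat) (F : nat -> R) (c : R)
    (G : nat -> R) : (n0 <= n1)%N ->
  close_from n0 (fun n => F n + c) G -> close_from n1 F G.
Proof.
move=> n01 [C FG]; exists (C + `|c|) => n n1n.
rewrite (_ : F n - G n = (F n + c - G n) - c); last by ring.
by rewrite (le_trans (ler_normB _ _))// lerD2r FG// (leq_trans n01).
Qed.

Lemma abel_bound (R : realType) (n0 n : nat) (C : R) (w D : nat -> R) :
  (forall m, (n0 <= m)%N -> 0 <= w m) ->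
  (forall m, (n0 <= m)%N -> w m.+1 <= w m) ->
  (forall m, (n0 <= m)%N -> `|D m| <= C) -> (n0 <= n)%N ->
  `|\sum_(n0 <= m < n) w m.+1 * (D m.+1 - D m)| <= 2 * C * w n0.
Proof.
move=> w0 wdec DC n0n.
have wD m : (n0 <= m)%N -> `|w m * D m| <= w m * C.
  by move=> mn; rewrite normrM ger0_norm ?w0// ler_wpM2l ?w0 ?DC.
(* By parts, the difference is [- w n0 D n0 + sum D m (w m - w m.+1)]. In absolute value the first
   term is at most [C w n0] and the sum, [w] being decreasing, at most [C (w n0 - w n)]. *)
suff H : `|\sum_(n0 <= m < n) w m.+1 * (D m.+1 - D m) - w n * D n| <=
    C * (2 * w n0 - w n).
  rewrite -[X in `|X|](subrK (w n * D n)) (le_trans (ler_normD _ _))//.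
  by apply: (le_trans (lerD H (wD n n0n))); lra.
elim: n n0n => [|n IH].
  rewrite leqn0 => /eqP n00; rewrite n00 in wD *.
  rewrite big_geq// sub0r normrN (le_trans (wD _ _))//.
  by lra.
rewrite leq_eqVlt => /predU1P[<-|].
  by rewrite big_geq// sub0r normrN (le_trans (wD _ _))//; lra.
rewrite ltnS => n0n; rewrite big_nat_recr//=.
move: (IH n0n); move: (\sum_(n0 <= m < n) _) => S hS.
rewrite (_ : _ - _ = (S - w n * D n) + D n * (w n - w n.+1)); last by ring.
rewrite (le_trans (ler_normD _ _))//.
have : `|D n * (w n - w n.+1)| <= C * (w n - w n.+1).
  have h : 0 <= w n - w n.+1 by rewrite subr_ge0 wdec.
  by rewrite normrM (ger0_norm h) ler_wpM2r// DC.
lra.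
Qed.

Lemma abel_close (R : realType) (n0 : nat) (w F G : nat -> R) :
  (forall m, (n0 <= m)%N -> 0 <= w m) ->
  (forall m, (n0 <= m)%N -> w m.+1 <= w m) ->
  close_from n0 F G ->
  close_from n0 (fun n => \sum_(n0 <= m < n) w m.+1 * (F m.+1 - F m))
                (fun n => \sum_(n0 <= m < n) w m.+1 * (G m.+1 - G m)).
Proof.
move=> w0 wdec [C FG]; exists (2 * C * w n0) => n n0n; rewrite -sumrB.
rewrite (eq_bigr (fun m => w m.+1 * ((F m.+1 - G m.+1) - (F m - G m)))).
  exact: (@abel_bound R n0 n C w (fun m => F m - G m)).
by move=> m _; ring.
Qed.

(** A discrete [int dL / L = ln L]. Each increment of [ln L] lies between [dL / L m.+1] and
    [dL / L m]; as [dL <= 1], these differ by at most [1 / L m - 1 / L m.+1], which telescopes. *)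
Lemma sum_log_weight (R : realType) (n0 : nat) (L : nat -> R) :
  (forall m, (n0 <= m)%N -> 0 < L m) ->
  (forall m, (n0 <= m)%N -> L m <= L m.+1 <= L m + 1) ->
  close_from n0 (fun n => \sum_(n0 <= m < n) (L m.+1)^-1 * (L m.+1 - L m))
                (fun n => ln (L n)).
Proof.
move=> L0 Linc; exists (`|ln (L n0)| + (L n0)^-1) => n n0n.
suff : 0 <= ln (L n) - ln (L n0)
    - \sum_(n0 <= m < n) (L m.+1)^-1 * (L m.+1 - L m) <= (L n0)^-1 - (L n)^-1.
  have Ln0 : 0 < (L n)^-1 by rewrite invr_gt0 L0.
  move: (\sum_(_ <= _ < _) _) => S.
  by rewrite ler_norml; have := ler_norm (ln (L n0));
    have := ler_norm (- ln (L n0)); rewrite normrN; lra.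
elim: n n0n => [|n IH].
  by rewrite leqn0 => /eqP ->; rewrite big_geq// !subrr lexx.
rewrite leq_eqVlt => /predU1P[<-|]; first by rewrite big_geq// !subrr lexx.
rewrite ltnS => n0n; rewrite big_nat_recr//=.
move: (IH n0n); move: (\sum_(n0 <= m < n) _) => S hS.
have Ln := L0 _ n0n; have LSn := L0 _ (leqW n0n).
have /andP[L1 L2] := Linc _ n0n.
have := @ln_sub_le R _ _ Ln LSn; have := @ln_sub_ge R _ _ Ln LSn.
rewrite ![_ / _]mulrC.
have : (L n)^-1 * (L n.+1 - L n) - (L n.+1)^-1 * (L n.+1 - L n) <=
    (L n)^-1 - (L n.+1)^-1.
  have : 0 <= (L n)^-1 - (L n.+1)^-1 by rewrite subr_ge0 lef_pV2.
  nra.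
lra.
Qed.

(** Abel summation with the decreasing weight [1 / L] exchanges [F] for [L]. Every new logarithm
    below is produced by this lemma. *)
Lemma log_weight_close (R : realType) (n0 : nat) (F L : nat -> R) :
  (forall m, (n0 <= m)%N -> 0 < L m) ->
  (forall m, (n0 <= m)%N -> L m <= L m.+1 <= L m + 1) ->
  close_from n0 F L ->
  close_from n0 (fun n => \sum_(n0 <= m < n) (L m.+1)^-1 * (F m.+1 - F m))
                (fun n => ln (L n)).
Proof.
move=> L0 Linc FL; apply: close_from_trans (@sum_log_weight R n0 L L0 Linc).
apply: (@abel_close R n0 (fun m => (L m)^-1)) => // m n0m.
  by rewrite invr_ge0 ltW ?L0.
by rewrite lef_pV2 ?posrE ?L0 ?leqW//; case/andP: (Linc _ n0m).
Qed.

Lemma sum_nat_condS (R : realType) (Q : pred nat) (f : nat -> R) (n : nat) :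
  \sum_(0 <= p < n.+2 | Q p) f p =
  \sum_(0 <= p < n.+1 | Q p) f p + (Q n.+1)%:R * f n.+1.
Proof.
rewrite big_mkcond big_nat_recr//= -big_mkcond/=.
by case: (Q n.+1); rewrite ?mul1r ?mul0r.
Qed.

Lemma mertens2 (R : realType) (n0 : nat) : (2 <= n0)%N ->
  close_from n0 (fun n => \sum_(0 <= p < n.+1 | prime p) 1 / p%:R : R)
                (fun n => ln (ln n%:R)).
Proof.
move=> n02.
have L0 m : (2 <= m)%N -> 0 < ln (m%:R : R).
  by move=> m2; rewrite ln_gt0// ltr1n.
have := @log_weight_close R 2
  (fun n => \sum_(0 <= p < n.+1 | prime p) ln p%:R / p%:R)
  (fun n => ln n%:R) L0.
(* The weighted sum starts at [m = 2] and sees only the primes above 2; the constant removes the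
   term of [p = 2]. *)
move=> H; apply: (@close_from_shift R 2 n0 _
  (- \sum_(0 <= p < 3 | prime p) 1 / p%:R)) => //.
apply: eq_close_from (H _ _) => [n n2|m m2|].
- rewrite -(@telescope_sumr _ 2 n
    (fun n => \sum_(0 <= p < n.+1 | prime p) 1 / p%:R : R))//.
  apply: eq_big_nat => m /andP[m2 _]; rewrite !sum_nat_condS.
  rewrite ![_ + _ - _]addrAC !subrr !add0r.
  have := L0 m.+1 (leqW m2); move: (ln _) => l l0.
  by rewrite mulrCA; congr (_ * _); rewrite mulKf ?gt_eqF// mul1r.
- have m0 : 0 < (m%:R : R) by rewrite ltr0n (ltn_trans _ m2).
  have m1 : 1 <= (m%:R : R) by rewrite ler1n (ltn_trans _ m2).
  have := @ln_sub_le R m%:R m.+1%:R m0; rewrite ltr0n => /(_ isT).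
  rewrite -natrB// subSnn mul1r => h; apply/andP; split.
    by rewrite ler_ln ?posrE ?ltr0n ?(ltn_trans _ m2)// ler_nat.
  have : (m%:R)^-1 <= 1 :> R by rewrite invf_le1.
  lra.
- by exists (3 + ln 8) => n n2; rewrite mertens1// (ltn_trans _ n2).
Qed.

(* Abel summation for the counting function of [Q]; the boundary term
   [count / (n + 1)] is at most [1]. *)
Lemma sum_inv_close (R : realType) (Q : pred nat) (n0 : nat) :
  close_from n0 (fun n => \sum_(0 <= p < n.+1 | Q p) 1 / p%:R : R)
    (fun n => \sum_(n0 <= m < n)
       (count Q (iota 0 m.+2))%:R / (m.+1%:R * m.+2%:R)).
Proof.
pose s n : R := \sum_(0 <= p < n.+1 | Q p) 1 / p%:R.
pose c n : R := (count Q (iota 0 n.+1))%:R.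
(* The increment of [t] from [m] to [m.+1] is exactly [c m.+1 / (m.+1 m.+2)]. *)
pose t n := s n - c n / n.+1%:R.
have c01 n : 0 <= c n / n.+1%:R <= 1.
  rewrite divr_ge0 ?ler0n//= ler_pdivrMr ?ltr0n// mul1r ler_nat.
  by rewrite (leq_trans (count_size _ _))// size_iota.
exists (1 + `|t n0|) => n n0n.
rewrite (_ : \sum_(n0 <= m < n) _ = t n - t n0); last first.
  rewrite -telescope_sumr//; apply: eq_bigr => m _.
  rewrite /t /s sum_nat_condS /c -[in iota 0 m.+2]addn1 iotaD count_cat/= addn0.
  rewrite !natrD; set q := (Q m.+1 : nat)%:R.
  have : 0 < (m.+1%:R : R) by rewrite ltr0n.
  rewrite -[m.+2%:R]natr1; move: (m.+1%:R) => x x0.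
  by field; rewrite !gt_eqF//; lra.
rewrite -/(s n) [t n]/t (_ : _ - _ = c n / n.+1%:R + t n0); last by ring.
have /andP[c0 c1] := c01 n; rewrite (le_trans (ler_normD _ _))//.
by rewrite lerD2r ger0_norm.
Qed.

(** * Iterated logarithms *)

Lemma near_pinfty_nat (R : realType) (P : R -> Prop) :
  (\forall x \near +oo, P x) -> exists n0, forall n, (n0 <= n)%N -> P n%:R.
Proof.
move=> [M [_ MP]]; exists (Num.truncn M).+1 => n Mn; apply: MP.
by rewrite (lt_le_trans (truncnS_gt M))// ler_nat.
Qed.

Lemma iterlog_near_ge (R : realType) (j : nat) (A : R) :
  \forall x \near +oo, A <= iterlog j x.
Proof.
elim: j A => [|j IH] A; first by apply: nbhs_pinfty_ge; rewrite num_real.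
apply: filterS (IH (expR A)) => x Ax.
by rewrite -[A]expRK ler_ln ?posrE ?expR_gt0// (lt_le_trans _ Ax) ?expR_gt0.
Qed.

Lemma iterlog_near_ge1 (R : realType) (k : nat) :
  \forall x \near (+oo : set_system R),
    forall i, (i <= k)%N -> 1 <= iterlog i x.
Proof.
elim: k => [|k IH].
  by apply: filterS (iterlog_near_ge 0 1) => x x1 i; rewrite leqn0 => /eqP ->.
apply: filterS2 IH (iterlog_near_ge k.+1 1) => x IH x1 i.
by rewrite leq_eqVlt => /predU1P[->//|]; apply: IH.
Qed.

(** Since [ln] takes the value 0 on nonpositive reals, monotonicity requires the inner iterates to
    be positive; at the smaller point suffices. *)
Lemma iterlog_le (R : realType) (j : nat) (x y : R) :
  (forall i, (i < j)%N -> 0 < iterlog i x) -> x <= y ->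
  iterlog j x <= iterlog j y.
Proof.
elim: j => [//|j IH] x0 xy.
have xj := x0 j (ltnSn j).
have jxy : iterlog j x <= iterlog j y by apply: IH => // i /leqW/x0.
by rewrite [iterlog j.+1 x]/= ler_ln ?posrE// (lt_le_trans xj).
Qed.

(** The slope of [ln] is at most 1 above 1. This yields the bounded steps asked for by
    [log_weight_close]. *)
Lemma iterlog_lip (R : realType) (j : nat) (x y : R) :
  (forall i, (i < j)%N -> 1 <= iterlog i x) -> x <= y ->
  iterlog j y - iterlog j x <= y - x.
Proof.
elim: j => [//|j IH] x1 xy.
have xj := x1 j (ltnSn j); have xj0 := lt_le_trans ltr01 xj.
have jxy : iterlog j x <= iterlog j y.
  by apply: iterlog_le => // i /leqW/x1; apply: lt_le_trans.
apply: (@le_trans _ _ (iterlog j y - iterlog j x)); last first.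
  by apply: IH => // i /leqW/x1.
apply: (le_trans (ln_sub_le xj0 (lt_le_trans xj0 jxy))).
by rewrite ler_pdivrMr// ler_peMr// subr_ge0.
Qed.

Lemma LogS (R : realType) (k : nat) (t : R) :
  (0 < k)%N -> Log k.+1 t = Log k t * iterlog k.+1 t.
Proof. by move=> k0; rewrite /Log big_nat_recr. Qed.

Lemma Log_ge1 (R : realType) (k : nat) (t : R) :
  (forall i, (i <= k)%N -> 1 <= iterlog i t) -> 1 <= Log k t.
Proof.
case: k => [|k]; first by rewrite /Log big_geq.
elim: k => [|k IH] t1; first by rewrite /Log big_geq.
have h1 : 1 <= Log k.+1 t by apply: IH => i /leqW/t1.
by rewrite LogS// mulr_ege1// t1.
Qed.

Lemma truncn_natr (R : realType) (n : nat) : Num.truncn (n%:R : R) = n.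
Proof. exact: natrK. Qed.

Lemma primepi_nat (R : realType) (n : nat) :
  primepi (n%:R : R) = count prime (iota 0 n.+1).
Proof. by rewrite /primepi /primes_le truncn_natr size_filter. Qed.

Lemma primepi_gt0 (R : realType) (n : nat) :
  (2 <= n)%N -> (0 < primepi (n%:R : R))%N.
Proof.
by move=> n2; rewrite primepi_nat -has_count; apply/hasP; exists 2%N;
  rewrite // mem_iota.
Qed.

(** The weight [b(n)] that Abel summation puts in place of [1 / p]. *)
Definition primepi_density (R : realType) (n : nat) : R :=
  (primepi (n%:R : R))%:R / (n%:R * n.+1%:R).

Section Iterated_log_range.
Variables (R : realType) (k n0 : nat).
Hypothesis n0_ge2 : (2 <= n0)%N.
Hypothesis iterlog_ge1 : forall n, (n0 <= n)%N ->
  forall i, (i <= k)%N -> 1 <= iterlog i (n%:R : R).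

(** The index may reach [k.+1], one past the section hypothesis, because only iterates strictly
    below [i] have to be at least 1. *)
Lemma iterlog_nat_incr (i n : nat) : (i <= k.+1)%N -> (n0 <= n)%N ->
  iterlog i (n%:R : R) <= iterlog i (n.+1%:R : R) <= iterlog i (n%:R : R) + 1.
Proof.
move=> ik n0n; have n1 j : (j < i)%N -> 1 <= iterlog j (n%:R : R).
  by move=> ji; apply: iterlog_ge1 => //; rewrite -ltnS (leq_trans ji).
have nn1 : (n%:R : R) <= n.+1%:R by rewrite ler_nat.
rewrite iterlog_le//=; last by move=> j /n1; apply: lt_le_trans.
have := iterlog_lip n1 nn1; rewrite -natrB// subSnn; lra.
Qed.

Lemma sum_primepi_density_Log (j : nat) : (j < k)%N ->
  close_from n0
    (fun n => \sum_(n0 <= m < n)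
       lambda1 j.+1 (m.+1%:R : R) * primepi_density R m.+1)
    (fun n => iterlog j.+2 n%:R).
Proof.
elim: j => [|j IH] jk.
  (* [Log 1] is an empty product, so the base case is Mertens' second theorem after Abel
     summation. *)
  have := close_from_trans (close_from_sym (sum_inv_close R prime n0))
    (mertens2 R n0_ge2).
  apply: eq_close_from => n _; apply: eq_bigr => m _.
  by rewrite /lambda1 /Log big_geq// divr1 mul1r /primepi_density primepi_nat.
have jk' : (j < k)%N by rewrite ltnW.
(* The previous sum serves as [F] and [log_(j+2)] as [L]: the new weight is the factor missing from
   [1 / Log j.+2]. *)
have := log_weight_close _ _ (IH jk').
move=> H; apply: eq_close_from (H _ _) => [n n0n|m n0m|m n0m].
- apply: eq_big_nat => m /andP[n0m _].
  rewrite big_nat_recr//= addrAC subrr add0r mulrA; congr (_ * _).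
  by rewrite /lambda1 (@LogS R j.+1)// !div1r invfM mulrC.
- exact: lt_le_trans ltr01 (iterlog_ge1 n0m jk).
- by apply: iterlog_nat_incr; rewrite // leqW.
Qed.

End Iterated_log_range.

(** * Primes followed by a small gap *)

(** A single predicate behind both the count and the sum, in the form that [sum_inv_close] takes. *)
Definition small_gap (R : realType) (k : nat) (lam : R -> R) (p : nat) : bool :=
  [&& prime p, iterlog_pos k (p%:R : R)
    & prime_gap R p <= lam p%:R * ln p%:R].

Lemma small_gap_sumE (R : realType) (k : nat) (lam : R -> R) (x : R) :
  small_gap_sum k lam x =
  \sum_(0 <= p < (Num.truncn x).+1 | small_gap k lam p) 1 / p%:R.
Proof.
rewrite /small_gap_sum /primes_dom /primes_le !big_filter_cond.
rewrite /index_iota subn0.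
by apply: eq_bigl => p; rewrite /small_gap /= andbA.
Qed.

Lemma small_gap_countE (R : realType) (k : nat) (lam : R -> R) (x : R) :
  small_gap_count k lam x =
  count (small_gap k lam) (iota 0 (Num.truncn x).+1).
Proof.
rewrite /small_gap_count /primes_dom /primes_le !count_filter.
apply: eq_count => p; rewrite /small_gap /=.
case: (boolP (prime p)) => [pp|]; last by rewrite andbF.
rewrite andbT andbC ler_pdivrMr// ln_gt0// ltr1n.
exact: prime_gt1.
Qed.

(** The law at integers, cleared of the division by [pi(n)], which is positive from [n = 2] on;
    nonnegativity of [lam] gives the integral its closed form. *)
Lemma small_gap_law_nat (R : realType) (k : nat) (lam : R -> R) (n0 : nat)
    (e : R) :
  small_gap_law k lam -> (forall n, (n0 <= n)%N -> 0 <= lam n%:R) -> 0 < e ->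
  exists n1, forall n, (n1 <= n)%N ->
    `|(small_gap_count k lam (n%:R : R))%:R
      - (primepi (n%:R : R))%:R * (1 - expR (- lam n%:R))| <=
    e * ((primepi (n%:R : R))%:R * (1 - expR (- lam n%:R))).
Proof.
move=> /asymp_equivP H lam0 /H/near_pinfty_nat[n1 n1P].
exists (maxn 2 (maxn n0 n1)) => n; rewrite !geq_max => /and3P[n2 n0n n1n].
have := n1P n n1n; rewrite Rintegral_expRN ?lam0//.
have pi0 : 0 < ((primepi (n%:R : R))%:R : R) by rewrite ltr0n primepi_gt0.
set I := 1 - _; have I0 : 0 <= I.
  by rewrite subr_ge0 -[leRHS]expR0 ler_expR oppr_le0 lam0.
rewrite (ger0_norm I0); move: (_%:R) pi0 => P P0; move: (_%:R) => N h.
rewrite (_ : N - P * I = (N / P - I) * P); last by field; rewrite gt_eqF.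
by rewrite normrM (gtr0_norm P0) (mulrC P) mulrA ler_wpM2r// ltW.
Qed.

Lemma expRN_ge (R : realType) (x : R) : 1 - x <= expR (- x).
Proof. exact: expR_ge1Dx. Qed.

(** From [exp(-x) <= 1 / (1 + x)] one gets [1 - exp(-x) >= x / (1 + x) >= (1 - x) x]. *)
Lemma one_sub_expRN_ge (R : realType) (x e : R) :
  0 <= x <= e -> (1 - e) * x <= 1 - expR (- x).
Proof.
move=> /andP[x0 xe]; have := expR_ge1Dx x; have := expRxMexpNx_1 x.
have := expR_gt0 (- x); move: (expR _) (expR _) => v u u0 vu hv.
have : u * (1 + x) <= 1 by nra.
nra.
Qed.

Lemma small_gap_sum_close (R : realType) (k n0 : nat) (lam : R -> R) (e : R)
    (n1 : nat) :
  (forall n, (n1 <= n)%N ->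
    `|(small_gap_count k lam (n%:R : R))%:R
      - (primepi (n%:R : R))%:R * lam n%:R| <=
    e * ((primepi (n%:R : R))%:R * lam n%:R)) ->
  exists n2 C, (n0 <= n2)%N /\ forall n, (n2 <= n)%N ->
    `|small_gap_sum k lam n%:R
      - \sum_(n0 <= m < n) lam m.+1%:R * primepi_density R m.+1| <=
    e * (\sum_(n0 <= m < n) lam m.+1%:R * primepi_density R m.+1) + C.
Proof.
move=> n1P; set v := fun m : nat => lam m.+1%:R * primepi_density R m.+1.
have [C1 C1P] := sum_inv_close R (small_gap k lam) n0.
pose u m : R := (count (small_gap k lam) (iota 0 m.+2))%:R
  / (m.+1%:R * m.+2%:R).
have uv m : (n1 <= m)%N -> `|u m - v m| <= e * v m.
  move=> /leqW/n1P; rewrite small_gap_countE truncn_natr /u /v /primepi_density.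
  have q0 : 0 <= (m.+1%:R * m.+2%:R : R)^-1 by rewrite invr_ge0 mulr_ge0.
  move: (_^-1) q0 => q q0.
  move: (count _ _)%:R (primepi _)%:R (lam _) => N P l h.
  rewrite (_ : _ - _ = (N - P * l) * q); last by ring.
  rewrite normrM (ger0_norm q0) (_ : e * _ = e * (P * l) * q); last by ring.
  by rewrite ler_wpM2r.
(* [D] absorbs the finitely many terms below [n2], where the termwise estimate may fail. *)
pose n2 := maxn n0 n1; pose D := `|\sum_(n0 <= m < n2) (u m - v m)|
  - e * \sum_(n0 <= m < n2) v m.
have n02 : (n0 <= n2)%N by rewrite leq_maxl.
exists n2, (C1 + D); split => // n n2n.
have n0n := leq_trans n02 n2n.
rewrite (le_trans (ler_distD (\sum_(n0 <= m < n) u m) _ _))//.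
rewrite addrCA lerD//.
  by rewrite small_gap_sumE truncn_natr; apply: C1P.
rewrite -sumrB (big_cat_nat n02 n2n)/= [in leRHS](big_cat_nat n02 n2n)/=.
rewrite (le_trans (ler_normD _ _))//.
have : `|\sum_(n2 <= m < n) (u m - v m)| <= e * \sum_(n2 <= m < n) v m.
  rewrite (le_trans (ler_norm_sum _ _ _))// big_distrr/=.
  apply: ler_sum_nat => m /andP[n2m _]; apply: uv.
  by rewrite (leq_trans _ n2m)// leq_maxr.
by rewrite /D; lra.
Qed.

Lemma small_gap_sum_le (R : realType) (k : nat) (lam : R -> R) (x y : R) :
  (Num.truncn x <= Num.truncn y)%N ->
  0 <= small_gap_sum k lam x <= small_gap_sum k lam y.
Proof.
move=> xy; rewrite !small_gap_sumE sumr_ge0//=.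
have xy1 : ((Num.truncn x).+1 <= (Num.truncn y).+1)%N by [].
rewrite [leRHS](big_cat_nat _ xy1)//= lerDl.
by apply: sumr_ge0.
Qed.

Lemma iterlog_le_Log (R : realType) (k : nat) (t : R) : (2 <= k)%N ->
  (forall i, (i <= k)%N -> 1 <= iterlog i t) -> iterlog k t <= Log k t.
Proof.
case: k => // -[//|k] _ t1; rewrite LogS// ler_peMl//.
  by rewrite (le_trans ler01)// t1.
by apply: Log_ge1 => i ik; rewrite t1// leqW.
Qed.

(** Since [lambda1] tends to 0, [1 - exp(-lambda1)] may be replaced by [lambda1]: one half of [e]
    pays for the law, the other for this replacement. *)
Lemma lambda1_law (R : realType) (k : nat) (e : R) : (2 <= k)%N -> 0 < e ->
  small_gap_law k (@lambda1 R k) ->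
  exists n1, forall n, (n1 <= n)%N ->
    `|(small_gap_count k (@lambda1 R k) (n%:R : R))%:R
      - (primepi (n%:R : R))%:R * lambda1 k n%:R| <=
    e * ((primepi (n%:R : R))%:R * lambda1 k n%:R).
Proof.
move=> k2 e0 law; have e20 : 0 < e / 2 by rewrite divr_gt0.
have [n0 n0P] := near_pinfty_nat (iterlog_near_ge1 R k).
have [n1 n1P] := near_pinfty_nat (iterlog_near_ge k (e / 2)^-1).
have lam_itv n : (maxn n0 n1 <= n)%N -> 0 <= lambda1 k (n%:R : R) <= e / 2.
  rewrite geq_max => /andP[n0n n1n]; have n01 := n0P n n0n.
  have L1 := iterlog_le_Log k2 n01; have k1 := n01 k (leqnn k).
  rewrite /lambda1 div1r invr_ge0 (le_trans _ L1) ?(le_trans ler01)//=.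
  have L2 := le_trans (n1P n n1n) L1.
  rewrite -[leRHS]invrK lef_pV2 ?posrE ?invr_gt0//.
  by rewrite (lt_le_trans _ L2)// invr_gt0.
have lam_ge0 n : (maxn n0 n1 <= n)%N -> 0 <= lambda1 k (n%:R : R).
  by move=> /lam_itv/andP[].
have [n2 n2P] := small_gap_law_nat law lam_ge0 e20.
exists (maxn (maxn n0 n1) n2) => n; rewrite geq_max => /andP[n01n n2n].
have := n2P n n2n; have := one_sub_expRN_ge (lam_itv n n01n).
have := expRN_ge (lambda1 k (n%:R : R)).
have : 0 <= (primepi (n%:R : R))%:R :> R by [].
have := lam_ge0 n n01n.
move: (small_gap_count _ _ _)%:R (primepi _)%:R => N P.
move: (lambda1 _ _) (expR _) => l E l0 P0 El lE.
rewrite !ler_norml => /andP[h1 h2].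
have h3 : P * (1 - E) <= P * l by rewrite ler_wpM2l//; lra.
have h4 : P * ((1 - e / 2) * l) <= P * (1 - E) by rewrite ler_wpM2l.
have h5 : e / 2 * (P * (1 - E)) <= e / 2 * (P * l) by rewrite ler_wpM2l// ltW.
by apply/andP; split; nra.
Qed.

Lemma small_gap_sum_lambda1 (R : realType) (k : nat) : (2 <= k)%N ->
  small_gap_law k (@lambda1 R k) ->
  asymp_equiv (small_gap_sum k (@lambda1 R k)) (@iterlog R k.+1).
Proof.
move=> k2 law; apply/asymp_equivP => e e0.
have e20 : 0 < e / 2 by rewrite divr_gt0.
have [N0 N0P] := near_pinfty_nat (iterlog_near_ge1 R k.+1).
pose n0 := maxn 2 N0; have n02 : (2 <= n0)%N by rewrite leq_maxl.
have ge1 n : (n0 <= n)%N ->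
    forall i, (i <= k.+1)%N -> 1 <= iterlog i (n%:R : R).
  by rewrite geq_max => /andP[_ /N0P].
have ge1k n : (n0 <= n)%N -> forall i, (i <= k)%N -> 1 <= iterlog i (n%:R : R).
  by move=> n0n i ik; apply: ge1; rewrite // leqW.
have lam_ge0 n : (n0 <= n)%N -> 0 <= lambda1 k (n%:R : R).
  by move=> n0n; rewrite divr_ge0// (le_trans ler01)// Log_ge1//; apply: ge1k.
have [n1 n1P] := lambda1_law k2 e20 law.
have [n2 [C [n02' n2P]]] := small_gap_sum_close n0 n1P.
have kpred : (k.-1 < k)%N by rewrite prednK// ltnW.
have := sum_primepi_density_Log n02 ge1k kpred.
rewrite (prednK (ltnW k2)) => -[C' C'P].
(* [K] collects all bounded errors; its summand 1 bounds the change of [log_(k+1)] from [truncn x]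
   to [x]. Once [K] is at most [e / 2] times [log_(k+1) x], the total error is at most [e] times
   it. *)
pose K := e / 2 * C' + C + C' + 1.
have := iterlog_near_ge k.+1 (K / (e / 2)).
apply: filterS2 (nbhs_pinfty_ge (num_real (n2%:R : R))) => x n2x Kx.
have x0 : 0 <= x by rewrite (le_trans _ n2x).
set n := Num.truncn x.
have /andP[nx xn] : n%:R <= x < n.+1%:R := truncn_itv x0.
have n2n : (n2 <= n)%N by rewrite truncn_ge_nat.
have n0n := leq_trans n02' n2n.
have -> : small_gap_sum k (@lambda1 R k) x =
    small_gap_sum k (@lambda1 R k) n%:R.
  by rewrite !small_gap_sumE truncn_natr.
have G1 i : (i < k.+1)%N -> 1 <= iterlog i (n%:R : R).
  by move=> /ltnW/ge1; apply.
have Gl := iterlog_lip G1 nx.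
have Gm : iterlog k.+1 n%:R <= iterlog k.+1 x.
  by apply: iterlog_le => // i /G1; apply: lt_le_trans.
have G0 := ge1 n n0n k.+1 (leqnn _).
rewrite -natr1 in xn.
rewrite ler_pdivrMr// mulrC in Kx.
rewrite [`|iterlog _ _|]ger0_norm; last first.
  by rewrite (le_trans _ Gm)// (le_trans ler01).
move: (n2P n n2n) (C'P n n0n) Gl Gm G0 Kx; rewrite /K.
move: (iterlog _ x) (iterlog _ n%:R) (small_gap_sum _ _ _)
  (\sum_(_ <= _ < _) _).
move=> Gx Gn S V h1 h2 h3 h4 h5 h6.
move: h1 h2; rewrite !ler_norml => /andP[h1 h1'] /andP[h2 h2'].
by apply/andP; split; nra.
Qed.

Lemma small_gap_sum_lambda2 (R : realType) (k : nat) (eps : R) : (2 <= k)%N ->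
  0 < eps -> small_gap_law k (@lambda2 R k eps) ->
  bounded_fun (small_gap_sum k (@lambda2 R k eps) : R -> R^o).
Proof.
move=> k2 eps0 law.
have [N0 N0P] := near_pinfty_nat (iterlog_near_ge1 R k.+1).
pose n0 := maxn 2 N0; have n02 : (2 <= n0)%N by rewrite leq_maxl.
have ge1 n : (n0 <= n)%N ->
    forall i, (i <= k.+1)%N -> 1 <= iterlog i (n%:R : R).
  by rewrite geq_max => /andP[_ /N0P].
have ge1k n : (n0 <= n)%N -> forall i, (i <= k)%N -> 1 <= iterlog i (n%:R : R).
  by move=> n0n i ik; apply: ge1; rewrite // leqW.
pose G n : R := iterlog k.+1 n%:R.
pose w n : R := expR (- (eps * G n)).
have lamE n : (n0 <= n)%N -> lambda2 k eps n%:R = w n * lambda1 k n%:R.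
  move=> n0n; have H1 := ge1k n n0n k (leqnn k).
  rewrite /lambda2 /lambda1 /powR gt_eqF ?(lt_le_trans ltr01)//.
  by rewrite !div1r invfM mulrC /w expRN.
have lam_ge0 n : (n0 <= n)%N -> 0 <= lambda2 k eps (n%:R : R).
  move=> n0n; rewrite lamE// mulr_ge0 ?expR_ge0// divr_ge0//.
  by rewrite (le_trans ler01)// Log_ge1//; apply: ge1k.
have [n1 n1P] := small_gap_law_nat law lam_ge0 ltr01.
(* A crude constant is enough for boundedness: the law at [e = 1] puts the count between 0 and
   [2 pi(n) lambda2(n)]. *)
have N3 n : (maxn n0 n1 <= n)%N ->
    `|(small_gap_count k (@lambda2 R k eps) (n%:R : R))%:R
      - (primepi (n%:R : R))%:R * lambda2 k eps n%:R| <=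
    3 * ((primepi (n%:R : R))%:R * lambda2 k eps n%:R).
  rewrite geq_max => /andP[n0n n1n].
  have := n1P n n1n; have := expRN_ge (lambda2 k eps (n%:R : R)).
  have : 0 <= (primepi (n%:R : R))%:R :> R by [].
  have : 0 <= (small_gap_count k (@lambda2 R k eps) (n%:R : R))%:R :> R by [].
  have := lam_ge0 n n0n.
  move: (small_gap_count _ _ _)%:R (primepi _)%:R => N P.
  move: (lambda2 _ _ _) (expR _) => l E l0 N_ge0 P0 El.
  rewrite !ler_norml => /andP[h1 h2].
  have h3 : P * (1 - E) <= P * l by rewrite ler_wpM2l//; lra.
  by apply/andP; split; nra.
have [n2 [C [n02' n2P]]] := small_gap_sum_close n0 N3.
have kpred : (k.-1 < k)%N by rewrite prednK// ltnW.
have := sum_primepi_density_Log n02 ge1k kpred.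
rewrite (prednK (ltnW k2)) => VG.
have Gincr n : (n0 <= n)%N -> G n <= G n.+1.
  by move=> n0n; have /andP[] := iterlog_nat_incr ge1k (leqnn k.+1) n0n.
have wdec n : (n0 <= n)%N -> w n.+1 <= w n.
  by move=> n0n; rewrite ler_expR lerN2 (ler_wpM2l (ltW eps0))// Gincr.
(* [w] decreases, so Abel summation against it carries the estimate for [lambda1] over to
   [lambda2]. *)
have [C' C'P] : close_from n0
    (fun n => \sum_(n0 <= m < n)
       lambda2 k eps m.+1%:R * primepi_density R m.+1)
    (fun n => \sum_(n0 <= m < n) w m.+1 * (G m.+1 - G m)).
  apply: eq_close_from (abel_close (fun n _ => expR_ge0 _) wdec VG) => n n0n.
  apply: eq_big_nat => m /andP[n0m _].
  rewrite big_nat_recr//= addrAC subrr add0r mulrA.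
  by rewrite -lamE// leqW.
(* With [u = eps (G m.+1 - G m)], [w m = w m.+1 exp(u) >= w m.+1 (1 + u)], so each term is at most
   [(w m - w m.+1) / eps]. *)
have wG n : (n0 <= n)%N ->
    \sum_(n0 <= m < n) w m.+1 * (G m.+1 - G m) <= eps^-1 * w n0.
  move=> n0n; apply: (@le_trans _ _ (eps^-1 * (w n0 - w n))); last first.
    by rewrite ler_wpM2l ?invr_ge0 ?(ltW eps0)// gerBl expR_ge0.
  rewrite -opprB -telescope_sumr// -sumrN big_distrr/=.
  apply: ler_sum => m _; rewrite opprB mulrC ler_pdivlMl// mulrC.
  have -> : w m = w m.+1 * expR (eps * (G m.+1 - G m)).
    by rewrite /w -expRD; congr expR; ring.
  have := expR_ge1Dx (eps * (G m.+1 - G m)).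
  have := expR_ge0 (- (eps * G m.+1)).
  by rewrite -/(w m.+1); nra.
(* The factor 4 is the main term plus the relative error 3 of [N3]. *)
pose M := 4 * (C' + eps^-1 * w n0) + C.
have SM n : (n2 <= n)%N -> small_gap_sum k (@lambda2 R k eps) n%:R <= M.
  move=> n2n; have n0n := leq_trans n02' n2n.
  have := n2P n n2n; have := C'P n n0n; have := wG n n0n; rewrite /M.
  rewrite !ler_norml.
  move: (\sum_(_ <= _ < _) _) (\sum_(_ <= _ < _) _) => A B.
  by lra.
apply: filterS (nbhs_pinfty_ge (num_real M)) => L ML x _ /=.
(* The bound must hold at every [x]; the sum being monotone, a small [x] is raised to [n2]. *)
pose y : R := (maxn n2 (Num.truncn x))%:R.
have xy : (Num.truncn x <= Num.truncn y)%N by rewrite truncn_natr leq_maxr.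
have /andP[S0 Sxy] := small_gap_sum_le k (@lambda2 R k eps) xy.
by rewrite ger0_norm// (le_trans Sxy)// (le_trans (SM _ _))// leq_maxl.
Qed.

Unset Implicit Arguments.
Set Strict Implicit.

Theorem proposition3p1 (R : realType) (k : nat) (eps : R)
    (hk : (2 <= k)%N) (heps : 0 < eps)
    (h1 : small_gap_law k (@lambda1 R k))
    (h2 : small_gap_law k (@lambda2 R k eps)) :
  [/\ asymp_equiv (small_gap_sum k (@lambda1 R k)) (@iterlog R k.+1),
      @iterlog R k.+1 x @[x --> +oo] --> +oo
    & bounded_fun (small_gap_sum k (@lambda2 R k eps) : R -> R^o)].
Proof.
split; first exact: small_gap_sum_lambda1.
- by apply/cvgryPge => A; apply: iterlog_near_ge.
- exact: small_gap_sum_lambda2.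
Qed.
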